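(* Let $G_1$ and $G_2$ be two connected graphs, each with $n$ vertices and $m$ edges, having Laplacian spectra $0=\mu_n<\mu_{n-1}\leq\cdots\leq\mu_1$ and $0=\lambda_n<\lambda_{n-1}\leq\cdots\leq\lambda_1$, respectively. Let $p\geq n$ be a positive integer such that $$\frac{2m}{p+n}<\min(\mu_{n-1},\lambda_{n-1}).$$ Then $LE(G_1\vee\overline{K_p})=LE(G_2\vee\overline{K_p})$.
   Context: All graphs are finite, undirected and simple. For a graph $G$ with $N$ vertices and $M$ edges, adjacency matrix $A(G)$ and diagonal degree matrix $D(G)$, the Laplacian matrix is $L(G)=D(G)-A(G)$; its eigenvalues with multiplicity, $\mu_1,\dots,\mu_N$, form the Laplacian spectrum of $G$. The Laplacian energy is $LE(G)=\sum_{i=1}^{N}\left|\mu_i-\frac{2M}{N}\right|$. $\overline{K_p}$ is the graph on $p$ vertices with no edges, and the join $G\vee H$ is obtained from the disjoint union of $G$ and $H$ by adding all edges between vertices of $G$ and vertices of $H$. Writing $\mu_{n-1}$ presupposes $n\ge 2$. *)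

(* Defs.v *)
(* MathComp *)
From HB Require Import structures.
From mathcomp Require Import all_boot all_order all_algebra.
Set Implicit Arguments.
Unset Strict Implicit.
Unset Printing Implicit Defensive.
Import Order.TTheory GRing.Theory Num.Theory.
Local Open Scope ring_scope.

Record graph := Graph {
  vertex :> finType;
  adj : rel vertex;
  adj_sym : symmetric adj;
  adj_irrefl : irreflexive adj }.

Definition edges (G : graph) : {set {set G}} :=
  [set e : {set G} | [exists x, exists y, adj x y && (e == [set x; y])]].

Definition degree (G : graph) (x : G) : nat := #|[set y : G | adj x y]|.

Definition connected_graph (G : graph) : Prop :=
  forall x y : G, connect (@adj G) x y.

Section EmptyGraph.
Variable p : nat.
Definition empty_adj : rel 'I_p := fun _ _ => false.
Lemma empty_adj_sym : symmetric empty_adj. Proof. by []. Qed.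
Lemma empty_adj_irrefl : irreflexive empty_adj. Proof. by []. Qed.
Definition empty_graph : graph := Graph empty_adj_sym empty_adj_irrefl.
End EmptyGraph.

Section Join.
Variables G H : graph.
Definition join_adj : rel (G + H)%type := fun u v =>
  match u, v with
  | inl x, inl y => adj x y
  | inr x, inr y => adj x y
  | _, _ => true
  end.
Lemma join_adj_sym : symmetric join_adj.
Proof. by move=> [x|x] [y|y] //=; apply: adj_sym. Qed.
Lemma join_adj_irrefl : irreflexive join_adj.
Proof. by move=> [x|x] /=; apply: adj_irrefl. Qed.
Definition graph_join : graph := Graph join_adj_sym join_adj_irrefl.
End Join.

Section Laplacian.
Variables (C : numClosedFieldType) (G : graph).

Definition adjacency_mx : 'M[C]_#|G| :=
  \matrix_(i, j) (adj (enum_val i) (enum_val j))%:R.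

Definition degree_mx : 'M[C]_#|G| :=
  diag_mx (\row_i (degree (enum_val i))%:R).

Definition laplacian_mx : 'M[C]_#|G| := degree_mx - adjacency_mx.

(* The order of the list is unspecified; only its content as a multiset,
   fixed by laplacian_spectrumP, is meaningful. *)
Definition laplacian_spectrum : seq C :=
  sval (closed_field_poly_normal (char_poly laplacian_mx)).

Lemma laplacian_spectrumP :
  char_poly laplacian_mx = \prod_(mu <- laplacian_spectrum) ('X - mu%:P).
Proof.
rewrite /laplacian_spectrum; case: closed_field_poly_normal => r /= {1}->.
by rewrite (monicP (char_poly_monic _)) scale1r.
Qed.

Definition laplacian_energy : C :=
  \sum_(mu <- laplacian_spectrum) `|mu - (2 * #|edges G|)%:R / #|G|%:R|.

(* The eigenvalues are mu 1, ..., mu n; the other values of mu are irrelevant.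
   The last three clauses say 0 = mu n < mu (n-1) <= ... <= mu 1. *)
Definition ordered_laplacian_spectrum (n : nat) (mu : nat -> C) : Prop :=
  [/\ perm_eq [seq mu i | i <- iota 1 n] laplacian_spectrum,
      mu n = 0,
      mu n < mu n.-1
    & forall i : nat, (1 <= i)%N -> (i < n.-1)%N -> mu i.+1 <= mu i].

End Laplacian.

(* Main.v *)
(** If G has n vertices, m edges and Laplacian spectrum (mu_i), then the join of
G with p isolated vertices has spectrum 0, n + p, n (p - 1 times) and
p + mu_i (i < n); this comes from a Schur complement computation, the row of
ones being a left eigenvector of L(G). The average degree of the join is
p + 2m/(n+p) - p(p-n)/(n+p), so the hypotheses place every p + mu_i (i < n) above it
and the absolute values of these terms can be dropped. The energy then depends
on the mu_i only through their sum, the trace 2m. *)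

Require Import Defs.
From mathcomp Require Import all_boot all_order all_algebra.
From mathcomp Require Import perm ring.
Set Implicit Arguments.
Unset Strict Implicit.
Unset Printing Implicit Defensive.
Import Order.TTheory GRing.Theory Num.Theory.
Local Open Scope ring_scope.

(** * Determinants: reindexing and bordered matrices *)

Lemma det_mxsub_bij (R : comPzRingType) (k l : nat) (f : 'I_k -> 'I_l)
    (A : 'M[R]_l) :
  bijective f -> \det (mxsub f f A) = \det A.
Proof.
move=> f_bij.
have eq_kl: k = l by rewrite -[k]card_ord -[l]card_ord; apply: bij_eq_card f_bij.
subst l; have f_inj := bij_inj f_bij.
have ->: mxsub f f A = row_perm (perm f_inj) (col_perm (perm f_inj) A).
  by apply/matrixP=> i j; rewrite !mxE !permE.
rewrite row_permE col_permE !det_mulmx !det_perm odd_permV mulrCA -signr_addb.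
by rewrite addbb mulr1.
Qed.

(** The Laplacian of the join is indexed by ['I_#|K|] and its block form by ['I_(n + p)]. These
    types are not convertible, so the passage goes along a bijection. *)
Lemma char_poly_mxsub_bij (R : comNzRingType) (k l : nat) (f : 'I_k -> 'I_l)
    (A : 'M[R]_l) :
  bijective f -> char_poly (mxsub f f A) = char_poly A.
Proof.
move=> f_bij; rewrite /char_poly -(det_mxsub_bij _ f_bij); congr (\det _).
by apply/matrixP=> i j; rewrite !mxE (inj_eq (bij_inj f_bij)).
Qed.

(** Schur complement with denominators cleared, so that it applies to polynomial entries: right
    multiplication by [E] kills the lower-left block. *)
Lemma det_block_scalar (R : comPzRingType) (n p : nat) (M : 'M[R]_n)
    (u : 'M_(n, p)) (v : 'M_(p, n)) (a : R) :
  \det (block_mx M u v a%:M) * a ^+ n = a ^+ p * \det (a *: M - u *m v).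
Proof.
pose E : 'M_(n + p) := block_mx a%:M 0 (- v) 1%:M.
have <-: \det E = a ^+ n by rewrite det_lblock det1 mulr1 det_scalar.
rewrite -det_mulmx mulmx_block !mulmx0 !mulmx1 !add0r mulmxN mul_mx_scalar.
by rewrite mul_mx_scalar mul_scalar_mx scalerN subrr
  det_ublock det_scalar mulrC.
Qed.

(** Matrix determinant lemma, from computing the determinant of the block matrix [c, u; v, 1] by
    eliminating either off-diagonal block. *)
Lemma det_scalar_sub_rank1 (R : comPzRingType) (n : nat) (u : 'cV[R]_n)
    (v : 'rV_n) (c : R) :
  \det (c%:M - u *m v) * c = c ^+ n * (c - (v *m u) 0 0).
Proof.
have := det_block_scalar c%:M u v 1.
rewrite scale1r !expr1n mul1r mulr1 => <-.
pose E : 'M_(n + 1) := block_mx 1%:M (- u) 0 c%:M.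
have {2}<-: \det E = c by rewrite det_ublock det1 mul1r det_scalar1.
rewrite -det_mulmx mulmx_block !mulmx0 !mulmx1 !mul1mx !addr0.
rewrite mul_mx_scalar mul_scalar_mx scalerN addNr mulmxN det_lblock det_scalar
  det_mx11 [X in _ * X]mxE.
by rewrite [X in X + _]mxE [X in _ + X]mxE eqxx addrC.
Qed.

Lemma det_sub_const (R : idomainType) (n : nat) (M : 'M[R]_n) (a b c : R) :
  b != 0 -> const_mx 1 *m M = b *: const_mx 1 :> 'rV_n ->
  \det (a *: M - const_mx c) * (a * b) = a ^+ n * (a * b - c *+ n) * \det M.
Proof.
move=> b0 colM; apply: (mulfI (expf_neq0 n b0)).
pose u : 'cV[R]_n := const_mx c; pose v : 'rV[R]_n := const_mx 1.
have uv: u *m v = const_mx c.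
  by apply/matrixP=> i j; rewrite mxE big_ord1 !mxE mulr1.
(* The row [v] of ones satisfies [v *m M = b *: v], so [M] factors out on the right and a rank-one
   perturbation of a scalar matrix remains. The scaling by [b] is why [b ^+ n] is cancelled. *)
have factor: b *: (a *: M - const_mx c) = ((a * b)%:M - u *m v) *m M.
  rewrite mulmxBl mul_scalar_mx -mulmxA colM -scalemxAr uv scalerBr scalerA.
  by rewrite [b * a]mulrC.
have vu: (v *m u) 0 0 = c *+ n.
  rewrite mxE (eq_bigr (fun=> c)) ?sumr_const ?card_ord // => i _.
  by rewrite !mxE mul1r.
have := det_scalar_sub_rank1 u v (a * b); rewrite vu => rank1.
rewrite [LHS]mulrA -detZ factor det_mulmx mulrAC rank1 exprMn.
ring.
Qed.

Lemma det_block_const (R : idomainType) (n p : nat) (M : 'M[R]_n) (a b : R) :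
  a != 0 -> b != 0 -> const_mx 1 *m M = b *: const_mx 1 :> 'rV_n ->
  \det (block_mx M (const_mx 1 : 'M_(n, p)) (const_mx 1) a%:M) * (a * b) =
    a ^+ p * (a * b - (n * p)%:R) * \det M.
Proof.
move=> a0 b0 colM; apply: (mulfI (expf_neq0 n a0)).
rewrite [LHS]mulrA [_ * \det _]mulrC det_block_scalar.
have ->: (const_mx 1 : 'M_(n, p)) *m const_mx 1 = const_mx p%:R :> 'M[R]_n.
  apply/matrixP=> i j; rewrite !mxE (eq_bigr (fun=> 1)) ?sumr_const ?card_ord //.
  by move=> k _; rewrite !mxE mulr1.
rewrite -[LHS]mulrA det_sub_const // -[p%:R *+ n]mulrnA [(p * n)%N]mulnC.
ring.
Qed.

(** * Edge count and Laplacian spectrum of a single graph *)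

Lemma sum_degree (G : graph) : (\sum_(x : G) degree x = 2 * #|edges G|)%N.
Proof.
have ->: (\sum_(x : G) degree x = \sum_(e : G * G | adj e.1 e.2) 1)%N.
  rewrite -(pair_big_dep xpredT (@adj G) (fun _ _ => 1%N)) /=.
  by apply: eq_bigr => x _; rewrite sum1_card /degree cardsE.
(* Ordered adjacent pairs are grouped by their set of ends; each edge arises from exactly two pairs,
   distinct by irreflexivity. *)
rewrite (partition_big (fun e : G * G => [set e.1; e.2]) (mem (edges G))) /=;
  last first.
  move=> [x y] /= xy; rewrite inE.
  by apply/existsP; exists x; apply/existsP; exists y; rewrite xy eqxx.
rewrite [RHS]mulnC -sum_nat_const; apply: eq_bigr => e.
rewrite inE => /existsP[x /existsP[y /andP[xy /eqP->]]].
have neq_xy : x != y by apply: contraTneq xy => ->; rewrite adj_irrefl.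
rewrite sum1_card -[RHS](_ : #|[set (x, y); (y, x)]| = 2%N); last first.
  by rewrite cards2 xpair_eqE (negPf neq_xy).
apply: eq_card => -[z t]; rewrite unfold_in /= !inE !xpair_eqE.
apply/idP/idP => [/andP[zt /eqP eq_ztxy]|].
  have: z \in [set x; y] by rewrite -eq_ztxy set21.
  have: t \in [set x; y] by rewrite -eq_ztxy set22.
  rewrite !inE => /orP[] /eqP eq_t /orP[] /eqP eq_z;
    move: zt; rewrite eq_t eq_z ?adj_irrefl // => _; by rewrite !eqxx ?orbT.
by case/orP=> /andP[/eqP-> /eqP->]; rewrite ?eqxx ?xy // adj_sym xy setUC eqxx.
Qed.

Section LaplacianSpectrum.
Variables (C : numClosedFieldType) (G : graph).

Lemma laplacian_mxE (i j : 'I_#|G|) :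
  laplacian_mx C G i j =
    (degree (enum_val i))%:R *+ (i == j) - (adj (enum_val i) (enum_val j))%:R.
Proof. by rewrite !mxE. Qed.

Lemma laplacian_col_sum (j : 'I_#|G|) : \sum_i laplacian_mx C G i j = 0.
Proof.
under eq_bigr do rewrite laplacian_mxE.
rewrite sumrB (bigD1 j) //= eqxx big1 ?addr0 => [|i /negPf->] //.
apply/eqP; rewrite subr_eq0 mulr1n -natr_sum; apply/eqP; congr _%:R.
rewrite -(big_enum_val (fun x => adj x (enum_val j) : nat)) /degree -sum1dep_card.
by rewrite [LHS]big_mkcond; apply: eq_bigr => x _; rewrite adj_sym; case: adj.
Qed.

Lemma size_laplacian_spectrum : size (laplacian_spectrum C G) = #|G|.
Proof.
apply: succn_inj; rewrite -(size_char_poly (laplacian_mx C G)).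
by rewrite laplacian_spectrumP size_prod_XsubC.
Qed.

(** The second-highest coefficient of the characteristic polynomial is minus the sum of the roots
    and also minus the trace, which is the degree sum. *)
Lemma sum_laplacian_spectrum : (0 < #|G|)%N ->
  \sum_(x <- laplacian_spectrum C G) x = (2 * #|edges G|)%:R.
Proof.
move=> G0; apply: oppr_inj.
rewrite -coefPn_prod_XsubC ?size_laplacian_spectrum -?lt0n //.
rewrite -laplacian_spectrumP char_poly_trace // -sum_degree; congr (- _).
rewrite natr_sum [RHS]big_enum_val; apply: eq_bigr => i _.
by rewrite laplacian_mxE eqxx adj_irrefl subr0.
Qed.

Lemma char_poly_shift (z : C) :
  \det ('X%:M - map_mx polyC (laplacian_mx C G + z%:M)) =
    \prod_(x <- laplacian_spectrum C G) ('X - (z + x)%:P).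
Proof.
(* Substituting [X - z] for [X] is a ring morphism, so it commutes with the determinant and with the
   product over the roots. *)
pose f := comp_poly ('X - z%:P).
have ->: 'X%:M - map_mx polyC (laplacian_mx C G + z%:M) =
    map_mx f (char_poly_mx (laplacian_mx C G)).
  apply/matrixP=> i j; rewrite !mxE /f comp_polyB comp_polyC rmorphD /= rmorphMn /=.
  case: (i == j); last by rewrite !mulr0n addr0 comp_poly0.
  by rewrite !mulr1n comp_polyX; ring.
rewrite det_map_mx -/(char_poly _) laplacian_spectrumP rmorph_prod /=.
apply: eq_bigr => x _; rewrite /f comp_polyB comp_polyX comp_polyC polyCD.
ring.
Qed.

End LaplacianSpectrum.

(** * Laplacian spectrum of the join with isolated vertices *)

Section JoinEmpty.
Variables (C : numClosedFieldType) (G : graph) (p : nat).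
Local Notation n := #|G|.
Local Notation K := (graph_join G (empty_graph p)).

Lemma card_join_empty : #|K| = (n + p)%N.
Proof. by rewrite card_sum card_ord. Qed.

Lemma degree_join_inl (x : G) : degree (inl x : K) = (degree x + p)%N.
Proof.
rewrite /degree -!sum1dep_card big_sumType /=; congr (_ + _)%N.
by rewrite sum1_card card_ord.
Qed.

Lemma degree_join_inr (i : 'I_p) : degree (inr i : K) = n.
Proof.
rewrite /degree -sum1dep_card big_sumType /= [X in (_ + X)%N]big_pred0 ?addn0 //.
by rewrite sum1_card.
Qed.

Lemma card_edges_join_empty : #|edges K| = (#|edges G| + n * p)%N.
Proof.
apply/eqP; rewrite -(eqn_pmul2l (isT : (0 < 2)%N)) -sum_degree big_sumType /=.
rewrite (eq_bigr _ (fun x _ => degree_join_inl x)).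
rewrite [X in (_ + X)%N](eq_bigr _ (fun i _ => degree_join_inr i)).
rewrite big_split /= sum_degree !sum_nat_const card_ord.
by apply/eqP; ring.
Qed.

(** Lists the vertices of [G] before the [p] added ones, which puts the Laplacian of the join in
    block form. *)
Definition join_vertex (i : 'I_(n + p)) : K :=
  match split i with inl j => inl (enum_val j) | inr j => inr j end.

Lemma join_vertex_lshift (i : 'I_n) : join_vertex (lshift p i) = inl (enum_val i).
Proof. by rewrite /join_vertex -/(unsplit (inl i)) unsplitK. Qed.

Lemma join_vertex_rshift (i : 'I_p) : join_vertex (rshift n i) = inr i.
Proof. by rewrite /join_vertex -/(unsplit (inr i)) unsplitK. Qed.

Lemma join_vertex_bij : bijective join_vertex.
Proof.
exists (fun v : K =>
  match v with inl x => lshift p (enum_rank x) | inr j => rshift n j end).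
- by move=> i; case: (split_ordP i) => j ->;
    rewrite ?join_vertex_lshift ?join_vertex_rshift ?enum_valK.
- by case=> x; rewrite ?join_vertex_lshift ?join_vertex_rshift ?enum_rankK.
Qed.

Lemma laplacian_join_empty :
  mxsub (enum_rank \o join_vertex) (enum_rank \o join_vertex) (laplacian_mx C K) =
  block_mx (laplacian_mx C G + p%:R%:M) (- const_mx 1) (- const_mx 1) n%:R%:M.
Proof.
have e_inj : injective (enum_rank \o join_vertex).
  by apply: inj_comp (bij_inj join_vertex_bij); apply: enum_rank_inj.
apply/matrixP=> i j; rewrite [LHS]mxE laplacian_mxE (inj_eq e_inj) /= !enum_rankK.
case: (split_ordP i) => k ->; case: (split_ordP j) => l ->;
  rewrite ?(block_mxEul, block_mxEur, block_mxEdl, block_mxEdr)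
    ?(eq_lshift, eq_rshift, eq_lrshift, eq_rlshift)
    ?join_vertex_lshift ?join_vertex_rshift
    ?degree_join_inl ?degree_join_inr.
- rewrite [RHS]mxE laplacian_mxE [p%:R%:M _ _]mxE natrD mulrnDl /=; ring.
- by rewrite !mxE /= mulr0n sub0r.
- by rewrite !mxE /= mulr0n sub0r.
- by rewrite !mxE /= subr0.
Qed.

(* The entries n and p added on the left stand for removing from the right one n
   and the shift p + 0 of the zero eigenvalue of G. *)
Lemma laplacian_spectrum_join_empty :
  perm_eq [:: n%:R, p%:R & laplacian_spectrum C K]
    [:: 0, (n + p)%:R & nseq p n%:R ++
       [seq p%:R + x | x <- laplacian_spectrum C G]].
Proof.
apply: prod_XsubC_eq.
rewrite !big_cons big_cat big_map /= big_nseq -laplacian_spectrumP -char_poly_shift.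
have e_bij : bijective (enum_rank \o join_vertex).
  exact: bij_comp (@enum_rank_bij _) join_vertex_bij.
rewrite -(char_poly_mxsub_bij (laplacian_mx C K) e_bij) laplacian_join_empty.
set M := 'X%:M - _.
have map1 k l : map_mx polyC (const_mx 1 : 'M[C]_(k, l)) = const_mx 1.
  by apply/matrixP=> i j; rewrite !mxE.
have ->: char_poly (block_mx (laplacian_mx C G + p%:R%:M)
    (- const_mx 1 : 'M_(_, p)) (- const_mx 1) n%:R%:M) =
    \det (block_mx M (const_mx 1 : 'M_(_, p)) (const_mx 1) ('X - n%:R%:P)%:M).
  rewrite /char_poly /char_poly_mx scalar_mx_block map_block_mx opp_block_mx.
  rewrite add_block_mx !map_mxN !map1 !opprK !add0r.
  by rewrite map_scalar_mx raddfB.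
(* The columns of the Laplacian of [G] sum to 0, so those of [M] sum to [X - p]. *)
have colM : const_mx 1 *m M = ('X - p%:R%:P) *: const_mx 1 :> 'rV_n.
  apply/rowP=> j; rewrite mxE mxE mxE mulr1.
  rewrite (eq_bigr (fun i => (if i == j then 'X - p%:R%:P else 0)
      - (laplacian_mx C G i j)%:P)) => [|i _]; last first.
    rewrite !mxE mul1r rmorphD rmorphMn /= -mulrb mulrnBl.
    by rewrite opprD addrCA addrC.
  by rewrite sumrB -rmorph_sum laplacian_col_sum subr0 -big_mkcond big_pred1_eq.
have XsubC0 (c : C) : 'X - c%:P != 0 by rewrite polyXsubC_eq0.
(* Here [a = X - n] and [b = X - p]; the factor [a * b - n * p] equals [X * (X - (n + p))], giving
   the roots 0 and [n + p]. *)
rewrite mulrA [LHS]mulrC det_block_const // iter_mulr_1 subr0.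
rewrite !polyC_natr natrD natrM.
ring.
Qed.

End JoinEmpty.

(** * Laplacian energy of the join *)

Lemma ordered_spectrum_ge (C : numClosedFieldType) (G : graph) (n : nat)
    (mu : nat -> C) (i : nat) :
  ordered_laplacian_spectrum G n mu -> (0 < i < n)%N -> mu n.-1 <= mu i.
Proof.
case=> _ _ _ mu_noninc /andP[i0 ltin].
have lein : (i <= n.-1)%N by rewrite -ltnS (ltn_predK ltin).
(* Induction on the gap [k] between [i] and [n - 1], with [i] general because the step passes to
   [i + 1]. *)
rewrite -(subnKC lein); move: (n.-1 - i)%N (subnKC lein) => k.
elim: k => [|k IHk] in i i0 {ltin lein} *; first by rewrite addn0.
rewrite addnS -addSn => eq_n; apply: le_trans (IHk _ _ eq_n) _ => //.
by apply: mu_noninc; rewrite // -eq_n addSn ltnS leq_addr.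
Qed.

(** Isolates a value depending on [n], [m] and [p] only, hence common to both graphs. The
    multiplicity [p - 1] of the eigenvalue [n] appears as [p] copies minus one. *)
Lemma laplacian_energy_join_empty (C : numClosedFieldType) (G : graph)
    (n m p : nat) (mu : nat -> C) :
  (2 <= n)%N -> #|G| = n -> #|edges G| = m ->
  ordered_laplacian_spectrum G n mu -> (n <= p)%N ->
  (2 * m)%:R / (p + n)%:R < mu n.-1 ->
  let avg := (2 * (m + n * p))%:R / (n + p)%:R in
  laplacian_energy C (graph_join G (empty_graph p)) =
    `|avg| + `|(n + p)%:R - avg| + `|n%:R - avg| *+ p - `|n%:R - avg|
    + (p%:R - avg) *+ n.-1 + (2 * m)%:R.
Proof.
move=> n2 cardG edgesG mu_spec lenp lt_mu avg.
have n0 : (0 < n)%N := ltnW n2.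
have np0 : (n + p)%:R != 0 :> C by rewrite pnatr_eq0 addn_eq0 negb_and -lt0n n0.
have [mu_perm mun _ _] := mu_spec.
have shift_ge0 i : (0 < i < n)%N -> 0 <= p%:R + mu i - avg.
  move=> /(ordered_spectrum_ge mu_spec)/(lt_le_trans lt_mu)/ltW le_mu.
  (* The first summand is nonnegative by the bound on [mu n.-1], the second because [n <= p], which
     also makes the natural subtraction exact. *)
  have ->: p%:R + mu i - avg =
      (mu i - (2 * m)%:R / (p + n)%:R) + (p * (p - n))%:R / (n + p)%:R.
    rewrite /avg [(p + n)%N]addnC !natrM (natrB _ lenp) !natrD natrM.
    by field; rewrite -natrD.
  by rewrite addr_ge0 ?subr_ge0 // divr_ge0 ?ler0n.
have iotaE : iota 1 n = index_iota 1 n.+1 by rewrite /index_iota subn1.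
have sum_mu : \sum_(1 <= i < n) mu i = (2 * m)%:R.
  rewrite -edgesG -(sum_laplacian_spectrum C) ?cardG // -(perm_big _ mu_perm) /=.
  by rewrite big_map iotaE big_nat_recr //= mun addr0.
(* The term of [mu n = 0] is kept apart with its absolute value, as the sign of [p - avg] is not
   controlled by the bound on the other eigenvalues. *)
have sum_shift : \sum_(x <- laplacian_spectrum C G) `|p%:R + x - avg| =
    (p%:R - avg) *+ n.-1 + (2 * m)%:R + `|p%:R - avg|.
  rewrite -(perm_big _ mu_perm) /= big_map iotaE.
  rewrite big_nat_recr //= mun addr0 -sum_mu; congr (_ + _).
  rewrite -subn1 -sumr_const_nat -big_split /=; apply: eq_big_nat => i lti.
  by rewrite ger0_norm ?shift_ge0 // addrAC.
have := perm_big (P := xpredT) (F := fun x => `|x - avg|) (op := +%R) (x := 0) _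
  (laplacian_spectrum_join_empty C G p).
rewrite !big_cons big_cat big_map /= big_nseq iter_addr_0 sum_shift sub0r normrN
  cardG => energy_eq.
rewrite /laplacian_energy card_join_empty card_edges_join_empty cardG edgesG -/avg.
(* These are the terms of the extra entries [p] and [n] in the permutation: the first cancels the
   term of [mu n], the second accounts for the subtracted one. *)
apply: (addrI `|p%:R - avg|); apply: (addrI `|n%:R - avg|).
by rewrite energy_eq; ring.
Qed.

Theorem theorem3p6 (C : numClosedFieldType) (G1 G2 : graph) (n m p : nat)
    (mu lambda : nat -> C) :
  (2 <= n)%N ->
  connected_graph G1 -> connected_graph G2 ->
  #|G1| = n -> #|G2| = n ->
  #|edges G1| = m -> #|edges G2| = m ->
  ordered_laplacian_spectrum G1 n mu ->
  ordered_laplacian_spectrum G2 n lambda ->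
  (0 < p)%N -> (n <= p)%N ->
  (2 * m)%:R / (p + n)%:R < Num.min (mu n.-1) (lambda n.-1) ->
  laplacian_energy C (graph_join G1 (empty_graph p)) =
  laplacian_energy C (graph_join G2 (empty_graph p)).
Proof.
move=> n2 _ _ card1 card2 edges1 edges2 spec1 spec2 _ lenp.
(* The order on [C] is partial, so the bound by the minimum splits only for comparable values;
   positivity makes both real. *)
have mu0 : 0 < mu n.-1 by case: spec1 => _ {1}<-.
have lambda0 : 0 < lambda n.-1 by case: spec2 => _ {1}<-.
rewrite comparable_lt_min; last by rewrite real_comparable ?gtr0_real.
case/andP=> lt_mu lt_lambda.
rewrite (laplacian_energy_join_empty n2 card1 edges1 spec1 lenp lt_mu).
by rewrite (laplacian_energy_join_empty n2 card2 edges2 spec2 lenp lt_lambda).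
Qed.
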